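(* Let $\mathfrak{g}$ be a $6$-dimensional real Lie algebra with a coherent splitting $\mathfrak{g}^*=V_1\oplus V_2$ such that $h^{0,4}=0$ and $h^{0,3}=0$. Then $\mathfrak{g}$ has no half-flat structure.
   Context: Let $d\colon\Lambda^k\mathfrak{g}^*\to\Lambda^{k+1}\mathfrak{g}^*$ be the Chevalley–Eilenberg differential ($d\alpha(X,Y)=-\alpha([X,Y])$ on $1$-forms, extended as a derivation). An $\mathrm{SU}(3)$-structure on a $6$-dimensional Lie algebra $\mathfrak{g}$ is a pair $(\omega,\psi^+)\in\Lambda^2\mathfrak{g}^*\times\Lambda^3\mathfrak{g}^*$ such that for some basis $\eta^1,\dots,\eta^6$ of $\mathfrak{g}^*$ and some $3$-form $\psi^-$ one has $\omega=\eta^{12}+\eta^{34}+\eta^{56}$ and $\psi^++i\psi^-=(\eta^1+i\eta^2)\wedge(\eta^3+i\eta^4)\wedge(\eta^5+i\eta^6)$. It is half-flat if $d\omega\wedge\omega=0$ and $d\psi^+=0$. A coherent splitting of $\mathfrak{g}$ is a decomposition $\mathfrak{g}^*=V_1\oplus V_2$ into vector subspaces with $\dim V_1=2$ such that, setting $\Lambda^{p,q}=\Lambda^pV_1\otimes\Lambda^qV_2\subset\Lambda^{p+q}\mathfrak{g}^*$, one has $d(\Lambda^{p,q})\subset\Lambda^{p+1,q}+\Lambda^{p+2,q-1}$ for all $p,q$. For such a splitting let $F^k_p=\bigoplus_{p'\ge p}\Lambda^{p',k-p'}$, let $Z^k$ be the space of closed $k$-forms, $H^k$ the $k$-th cohomology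 of $(\Lambda^*\mathfrak{g}^*,d)$, and $H^k_p\subset H^k$ the image of $Z^k\cap F^k_p$. Define $H^{p,q}=H^{p+q}_p/H^{p+q}_{p+1}$ and $h^{p,q}=\dim H^{p,q}$. *)

(* Defs.v *)
(* Exterior algebra of the dual of a 6-dimensional real Lie
   algebra, in coordinates w.r.t. a fixed basis e_0..e_5 of g and its dual
   basis e^0..e^5 of g^*. *)
From HB Require Import structures.
From mathcomp Require Import all_boot all_order all_algebra.
From mathcomp Require Import reals.
Set Implicit Arguments. Unset Strict Implicit. Unset Printing Implicit Defensive.
Import Order.TTheory GRing.Theory Num.Theory.
Local Open Scope ring_scope.

Section Forms.
Variable R : fieldType.

(* A (mixed-degree) lform on g: coefficients alpha(I) of e^I, where for
   I = {i_1 < ... < i_k}, e^I = e^{i_1} /\ ... /\ e^{i_k}. *)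
Definition lform := {ffun {set 'I_6} -> R^o}.

Definition ebase (I : {set 'I_6}) : lform := [ffun J => (J == I)%:R].

Definition wsign (I J : {set 'I_6}) : R :=
  (-1) ^+ #|[set p : 'I_6 * 'I_6 | [&& p.1 \in I, p.2 \in J & (p.2 < p.1)%N]]|.

Definition wedge (a b : lform) : lform :=
  \sum_(I : {set 'I_6}) \sum_(J : {set 'I_6})
     ((a I * b J * (if [disjoint I & J] then wsign I J else 0)) *: ebase (I :|: J)).

Definition wedgel (s : seq lform) : lform := foldr wedge (ebase set0) s.

Definition Lambda (k : nat) : {vspace lform} :=
  <<[seq ebase X | X <- enum [set X : {set 'I_6} | #|X| == k]]>>%VS.

(* Lie algebra with structure constants [e_i, e_j] = sum_k c i j k e_k *)
Definition is_lie (c : 'I_6 -> 'I_6 -> 'I_6 -> R) : Prop :=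
  (forall i j k, c i j k = - c j i k) /\
  (forall i j k l, \sum_(m < 6) (c i j m * c m k l + c j k m * c m i l
                                 + c k i m * c m j l) = 0).

(* Chevalley-Eilenberg differential: d e^k (e_i, e_j) = - e^k([e_i,e_j]),
   i.e. d e^k = - sum_{i<j} c i j k e^{ij}; extended as a derivation *)
Definition d1 (c : 'I_6 -> 'I_6 -> 'I_6 -> R) (k : 'I_6) : lform :=
  \sum_(i < 6) \sum_(j < 6 | (i < j)%N) (- c i j k) *: ebase [set i; j].

Fixpoint dlist (c : 'I_6 -> 'I_6 -> 'I_6 -> R) (s : seq 'I_6) : lform :=
  match s with
  | [::] => 0
  | i :: s' => wedge (d1 c i) (wedgel [seq ebase [set x] | x <- s'])
               - wedge (ebase [set i]) (dlist c s')
  end.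

(* enum I lists the elements of I in increasing order *)
Definition dCE (c : 'I_6 -> 'I_6 -> 'I_6 -> R) (a : lform) : lform :=
  \sum_(I : {set 'I_6}) (a I *: dlist c (enum I)).

Definition Zk c (k : nat) : {vspace lform} :=
  (lker (linfun (dCE c)) :&: Lambda k)%VS.
Definition Bk c (k : nat) : {vspace lform} :=
  (linfun (dCE c) @: Lambda k.-1)%VS.

(* Lambda^{p,q} = Lambda^p V1 (x) Lambda^q V2, spanned by wedges of p basis
   vectors of V1 followed by q basis vectors of V2 *)
Definition Lpq (V1 V2 : {vspace lform}) (p q : nat) : {vspace lform} :=
  <<[seq wedgel ([seq tnth (vbasis V1) (f i) | i <- enum 'I_p] ++
                 [seq tnth (vbasis V2) (g j) | j <- enum 'I_q])
    | f : {ffun 'I_p -> 'I_(\dim V1)} <- enum {ffun 'I_p -> 'I_(\dim V1)},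
      g : {ffun 'I_q -> 'I_(\dim V2)} <- enum {ffun 'I_q -> 'I_(\dim V2)}]>>%VS.

(* g^* = V1 (+) V2 with dim V1 = 2, and
   d(Lambda^{p,q}) <= Lambda^{p+1,q} + Lambda^{p+2,q-1}  (Lambda^{p+2,-1} = 0) *)
Definition coherent_splitting c (V1 V2 : {vspace lform}) : Prop :=
  [/\ (V1 + V2)%VS = Lambda 1, (V1 :&: V2)%VS = 0%VS, \dim V1 = 2%N,
      (forall p a, a \in Lpq V1 V2 p 0 -> dCE c a \in Lpq V1 V2 p.+1 0) &
      (forall p q a, a \in Lpq V1 V2 p q.+1 ->
          dCE c a \in (Lpq V1 V2 p.+1 q.+1 + Lpq V1 V2 p.+2 q)%VS)].

Definition Fkp (V1 V2 : {vspace lform}) (k p : nat) : {vspace lform} :=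
  (\sum_(p' < k.+1 | (p <= p')%N) Lpq V1 V2 p' (k - p'))%VS.

(* dim H^k_p, where H^k_p = image of Z^k /\ F^k_p in H^k = Z^k/B^k,
   which is isomorphic to (Z^k /\ F^k_p + B^k) / B^k *)
Definition dimHkp c V1 V2 (k p : nat) : nat :=
  (\dim (Zk c k :&: Fkp V1 V2 k p + Bk c k) - \dim (Bk c k))%N.

(* h^{p,q} = dim (H^{p+q}_p / H^{p+q}_{p+1}) *)
Definition hpq c V1 V2 (p q : nat) : nat :=
  (dimHkp c V1 V2 (p + q) p - dimHkp c V1 V2 (p + q) p.+1)%N.

(* SU(3)-structure (omega, psi+): there is a basis eta of g^* and a 3-lform
   psi- with omega = eta^12+eta^34+eta^56 and
   psi+ + i psi- = (eta1 + i eta2)(eta3 + i eta4)(eta5 + i eta6),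
   i.e. (real and imaginary parts, a+ib,c+id,e+if: ace-adf-bcf-bde and
   acf+ade+bce-bdf) *)
Definition w2 (x y : lform) := wedge x y.
Definition w3 (x y z : lform) := wedge x (wedge y z).

Definition SU3_structure (om psp : lform) : Prop :=
  exists (eta : 'I_6 -> lform) (psm : lform),
    [/\ basis_of (Lambda 1) [seq eta i | i <- enum 'I_6],
        om = w2 (eta 0) (eta 1) + w2 (eta 2) (eta 3) + w2 (eta 4) (eta 5),
        psp = w3 (eta 0) (eta 2) (eta 4) - w3 (eta 0) (eta 3) (eta 5)
              - w3 (eta 1) (eta 2) (eta 5) - w3 (eta 1) (eta 3) (eta 4) &
        psm = w3 (eta 0) (eta 2) (eta 5) + w3 (eta 0) (eta 3) (eta 4)
              + w3 (eta 1) (eta 2) (eta 4) - w3 (eta 1) (eta 3) (eta 5)].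

Definition half_flat c (om psp : lform) : Prop :=
  SU3_structure om psp /\ wedge (dCE c om) om = 0 /\ dCE c psp = 0.

End Forms.

(* Main.v *)
(* Exactness raises the filtration, B^k <= F^k_1, so h^{0,k} = 0 forces every closed
   k-form into F^k_1, whose elements are killed by al /\ be for a basis al, be of V1.
   Half-flatness makes omega^2 and psi+ closed, hence omega^2 /\ al /\ be = 0 and
   psi+ /\ al /\ be = 0. Writing z, w in C^3 for the coordinates of al, be in the
   adapted coframe eta, these equations say Im <z, w> = 0 and z x w = 0; Lagrange's
   identity |z|^2 |w|^2 = |<z, w>|^2 + |z x w|^2 then makes Cauchy-Schwarz an equality
   over R, so al and be are linearly dependent, a contradiction. *)
Require Import Defs.
From HB Require Import structures.
From mathcomp Require Import all_boot all_order all_algebra.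
From mathcomp Require Import reals ring.
Set Implicit Arguments. Unset Strict Implicit. Unset Printing Implicit Defensive.
Import Order.TTheory GRing.Theory Num.Theory.
Local Open Scope ring_scope.

(** * Induction on spans, and the algebra of the wedge product *)

Lemma span_ind (K : fieldType) (vT : vectType K) (P : vT -> Prop) (X : seq vT) :
  P 0 -> (forall k u v, P u -> P v -> P (k *: u + v)) ->
  (forall x, x \in X -> P x) -> forall v, v \in <<X>>%VS -> P v.
Proof.
move=> P0 PD PX v /(@coord_span _ _ _ (in_tuple X)) ->.
elim/big_ind: _ => // [x y Px Py|i _]; first by rewrite -[x]scale1r; apply: PD.
by rewrite -[_ *: _]addr0; apply: PD => //; apply: PX; apply: mem_nth.
Qed.

Section Wedge.
Variable R : fieldType.
Implicit Types (a b x y z : lform R) (I J K : {set 'I_6}).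

Local Notation "a \w b" := (wedge a b) (at level 40, left associativity).
Local Notation e i := (ebase R [set i]).

Lemma formE a : a = \sum_I a I *: ebase R I.
Proof.
apply/ffunP=> J; rewrite sum_ffunE (bigD1 J) //= big1 => [|I nIJ].
  by rewrite !ffunE eqxx addr0 [_ *: _]mulr1.
by rewrite !ffunE eq_sym (negPf nIJ) [_ *: _]mulr0.
Qed.

Lemma form_ind (P : lform R -> Prop) :
  P 0 -> (forall k u v, P u -> P v -> P (k *: u + v)) ->
  (forall I, P (ebase R I)) -> forall a, P a.
Proof.
move=> P0 PD PX a; rewrite [a]formE.
elim/big_ind: _ => // [x y Px Py|i _]; first by rewrite -[x]scale1r; apply: PD.
by rewrite -[_ *: _]addr0; apply: PD.
Qed.

Lemma wedge_linearl k x y b : (k *: x + y) \w b = k *: (x \w b) + y \w b.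
Proof.
rewrite /wedge scaler_sumr -big_split; apply: eq_bigr => I _ /=.
rewrite scaler_sumr -big_split; apply: eq_bigr => J _ /=.
by rewrite scalerA -scalerDl !ffunE mulrDl mulrDl -!mulrA.
Qed.

Lemma wedge_linearr k x y b : b \w (k *: x + y) = k *: (b \w x) + b \w y.
Proof.
rewrite /wedge scaler_sumr -big_split; apply: eq_bigr => I _ /=.
rewrite scaler_sumr -big_split; apply: eq_bigr => J _ /=.
rewrite scalerA -scalerDl !ffunE; congr (_ *: _).
by rewrite mulrDr mulrDl -[_ *: _]/(k * x J) mulrCA -!mulrA.
Qed.

Lemma wedge0l b : 0 \w b = 0.
Proof. by have := wedge_linearl (-1) 0 0 b; rewrite scaler0 add0r scaleN1r addNr. Qed.
Lemma wedge0r b : b \w 0 = 0.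
Proof. by have := wedge_linearr (-1) 0 0 b; rewrite scaler0 add0r scaleN1r addNr. Qed.
Lemma wedgeDl x y b : (x + y) \w b = x \w b + y \w b.
Proof. by have := wedge_linearl 1 x y b; rewrite !scale1r. Qed.
Lemma wedgeDr x y b : b \w (x + y) = b \w x + b \w y.
Proof. by have := wedge_linearr 1 x y b; rewrite !scale1r. Qed.
Lemma wedgeZl k x b : (k *: x) \w b = k *: (x \w b).
Proof. by have := wedge_linearl k x 0 b; rewrite !addr0 wedge0l addr0. Qed.
Lemma wedgeZr k x b : b \w (k *: x) = k *: (b \w x).
Proof. by have := wedge_linearr k x 0 b; rewrite !addr0 wedge0r addr0. Qed.
Lemma wedgeNl x b : (- x) \w b = - (x \w b).
Proof. by rewrite -scaleN1r wedgeZl scaleN1r. Qed.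
Lemma wedgeNr x b : b \w (- x) = - (b \w x).
Proof. by rewrite -scaleN1r wedgeZr scaleN1r. Qed.
Lemma wedge_suml (T : Type) (r : seq T) (F : T -> lform R) b :
  (\sum_(i <- r) F i) \w b = \sum_(i <- r) F i \w b.
Proof. by apply: (big_morph (fun x => x \w b)) => [x y|]; rewrite ?wedgeDl ?wedge0l. Qed.
Lemma wedge_sumr (T : Type) (r : seq T) (F : T -> lform R) b :
  b \w (\sum_(i <- r) F i) = \sum_(i <- r) b \w F i.
Proof. by apply: (big_morph (wedge b)) => [x y|]; rewrite ?wedgeDr ?wedge0r. Qed.

Definition wedge_coef I J : R := if [disjoint I & J] then wsign R I J else 0.

Lemma wedge_ebase I J : ebase R I \w ebase R J = wedge_coef I J *: ebase R (I :|: J).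
Proof.
rewrite /wedge (bigD1 I) //= [X in _ + X]big1 => [|I' nI]; last first.
  rewrite big1 // => J' _; rewrite !ffunE (negPf nI).
  by rewrite mul0r mul0r scale0r.
rewrite addr0 (bigD1 J) //= [X in _ + X]big1 => [|J' nJ]; last first.
  by rewrite !ffunE (negPf nJ) mulr0 mul0r scale0r.
by rewrite !ffunE !eqxx !mul1r addr0.
Qed.

(** As a product over pairs, the inversion sign is multiplicative under disjoint unions simply by
    splitting products. *)
Lemma wsignE I J : wsign R I J = \prod_(i in I) \prod_(j in J) (-1) ^+ (j < i)%N.
Proof.
rewrite /wsign pair_big /= -prodr_const.
rewrite big_mkcond [RHS]big_mkcond; apply: eq_bigr => -[i j] _ /=.
by rewrite inE /=; case: (i \in I); case: (j \in J); case: (j < i)%N.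
Qed.

Lemma wsignUl I J K :
  [disjoint I & J] -> wsign R (I :|: J) K = wsign R I K * wsign R J K.
Proof.
move=> dIJ; rewrite !wsignE -(bigU _ _ _ dIJ) /=.
by apply: eq_bigl => i; rewrite !inE.
Qed.

Lemma wsignUr I J K :
  [disjoint I & J] -> wsign R K (I :|: J) = wsign R K I * wsign R K J.
Proof.
move=> dIJ; rewrite !wsignE -big_split; apply: eq_bigr => k _ /=.
by rewrite -(bigU _ _ _ dIJ) /=; apply: eq_bigl => i; rewrite !inE.
Qed.

(** Disjointness gives [i != j] for every pair, so each pair is an inversion for exactly one of the
    two orders, and the two signs multiply to (-1)^(|I||J|). *)
Lemma wsignC I J :
  [disjoint I & J] -> wsign R I J = (-1) ^+ (#|I| * #|J|) * wsign R J I.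
Proof.
move=> dIJ; apply: (canRL (signrMK _)).
rewrite [in wsign R J I]wsignE exchange_big /= wsignE.
rewrite mulnC exprM -[(_ ^+ #|J|) ^+ #|I|]prodr_const -big_split; apply: eq_bigr => i iI /=.
rewrite -prodr_const -big_split; apply: eq_bigr => j jJ /=.
have: i != j by apply: contraTneq jJ => <-; rewrite (disjointFr dIJ).
by rewrite -val_eqE /=; case: ltngtP => //= _ _; rewrite !(expr0, expr1, mulr1, mulrNN).
Qed.

(** By trilinearity only basis forms matter. Both bracketings then carry the product of the three
    pairwise signs if I, J, K are pairwise disjoint, and 0 otherwise. *)
Lemma wedgeA x y z : x \w (y \w z) = x \w y \w z.
Proof.
elim/form_ind: x => [|k u v Hu Hv|I]; rewrite ?wedge0l ?wedge_linearl ?Hu ?Hv //.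
elim/form_ind: y => [|k u v Hu Hv|J];
  rewrite ?(wedge0l, wedge0r, wedge_linearl, wedge_linearr) ?Hu ?Hv //.
elim/form_ind: z => [|k u v Hu Hv|K];
  rewrite ?(wedge0l, wedge0r, wedge_linearl, wedge_linearr) ?Hu ?Hv //.
rewrite !wedge_ebase wedgeZl wedgeZr !wedge_ebase !scalerA setUA; congr (_ *: _).
rewrite /wedge_coef.
have dU (A B C : {set 'I_6}) : [disjoint A :|: B & C] = [disjoint A & C] && [disjoint B & C].
  by rewrite -!setI_eq0 setIUl setU_eq0.
rewrite dU [[disjoint I & _ :|: _]]disjoint_sym dU ![[disjoint _ & I]]disjoint_sym.
case dIJ: [disjoint I & J]; case dJK: [disjoint J & K]; case dIK: [disjoint I & K];
  rewrite ?(mulr0, mul0r) //=.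
by rewrite wsignUl // wsignUr //; ring.
Qed.

Lemma wedge_ebaseC I J :
  ebase R I \w ebase R J = (-1) ^+ (#|I| * #|J|) *: (ebase R J \w ebase R I).
Proof.
rewrite !wedge_ebase scalerA setUC /wedge_coef disjoint_sym.
by case: ifP => [d|_]; rewrite ?mulr0 // wsignC // disjoint_sym.
Qed.

Lemma Lambda_ind k (P : lform R -> Prop) :
  P 0 -> (forall k u v, P u -> P v -> P (k *: u + v)) ->
  (forall I, #|I| = k -> P (ebase R I)) -> forall a, a \in Lambda R k -> P a.
Proof.
move=> P0 PD PX a; apply: span_ind => // x /mapP[I].
by rewrite mem_enum inE => /eqP cI ->; apply: PX.
Qed.

Lemma ebase_Lambda I : ebase R I \in Lambda R #|I|.
Proof. by apply: memv_span; apply: map_f; rewrite mem_enum inE. Qed.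

Lemma e_Lambda i : e i \in Lambda R 1.
Proof. by have := ebase_Lambda [set i]; rewrite cards1. Qed.

Lemma wedge_Lambda j k a b :
  a \in Lambda R j -> b \in Lambda R k -> a \w b \in Lambda R (j + k).
Proof.
move=> aj bk; elim/Lambda_ind: aj => [|l u v Hu Hv|I cI].
- by rewrite wedge0l mem0v.
- by rewrite wedge_linearl memvD ?memvZ.
elim/Lambda_ind: bk => [|l u v Hu Hv|J cJ].
- by rewrite wedge0r mem0v.
- by rewrite wedge_linearr memvD ?memvZ.
rewrite wedge_ebase /wedge_coef; case: ifP => [d|_]; last by rewrite scale0r mem0v.
apply: memvZ; rewrite -cI -cJ; move: (ebase_Lambda (I :|: J)).
by rewrite cardsU disjoint_setI0 // cards0 subn0.
Qed.

Lemma wedgeC j k a b : a \in Lambda R j -> b \in Lambda R k ->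
  a \w b = (-1) ^+ (j * k) *: (b \w a).
Proof.
move=> aj bk; elim/Lambda_ind: aj => [|l u v Hu Hv|I cI].
- by rewrite wedge0l wedge0r scaler0.
- by rewrite wedge_linearl wedge_linearr Hu Hv scalerDr scalerA mulrC -scalerA.
elim/Lambda_ind: bk => [|l u v Hu Hv|J cJ].
- by rewrite wedge0l wedge0r scaler0.
- by rewrite wedge_linearl wedge_linearr Hu Hv scalerDr scalerA mulrC -scalerA.
by rewrite wedge_ebaseC cI cJ.
Qed.

Lemma wedge1C a b : a \in Lambda R 1 -> b \in Lambda R 1 -> a \w b = - (b \w a).
Proof. by move=> a1 b1; rewrite (wedgeC a1 b1) expr1 scaleN1r. Qed.

Lemma wedge2C a b : a \in Lambda R 2 -> a \w b = b \w a.
Proof.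
move=> a2; elim/form_ind: b => [|l u v Hu Hv|J]; first by rewrite wedge0l wedge0r.
  by rewrite wedge_linearl wedge_linearr Hu Hv.
by rewrite (wedgeC a2 (ebase_Lambda J)) exprM sqrrN expr1n expr1n scale1r.
Qed.

Lemma wedge1CA a b x :
  a \in Lambda R 1 -> b \in Lambda R 1 -> a \w (b \w x) = - (b \w (a \w x)).
Proof. by move=> a1 b1; rewrite wedgeA (wedge1C a1 b1) wedgeNl wedgeA. Qed.

Lemma wedge1l a : ebase R set0 \w a = a.
Proof.
elim/form_ind: a => [|k u v Hu Hv|I]; rewrite ?wedge0r ?wedge_linearr ?Hu ?Hv //.
rewrite wedge_ebase set0U /wedge_coef -setI_eq0 set0I eqxx wsignE big_set0.
by rewrite scale1r.
Qed.

Lemma wedge1r a : a \w ebase R set0 = a.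
Proof.
elim/form_ind: a => [|k u v Hu Hv|I]; rewrite ?wedge0l ?wedge_linearl ?Hu ?Hv //.
by rewrite wedge_ebaseC cards0 muln0 scale1r wedge1l.
Qed.

Lemma wedgel_cat s t : wedgel (s ++ t) = wedgel s \w wedgel t :> lform R.
Proof. by elim: s => [|x s IH] /=; rewrite ?wedge1l // IH wedgeA. Qed.

Lemma wedgel_Lambda (s : seq (lform R)) :
  {subset s <= Lambda R 1} -> wedgel s \in Lambda R (size s).
Proof.
elim: s => [_|x s IH sub] /=; first by have := ebase_Lambda set0; rewrite cards0.
apply: (@wedge_Lambda 1 (size s)); first by apply: sub; rewrite inE eqxx.
by apply: IH => y ys; apply: sub; rewrite inE ys orbT.
Qed.

Lemma wedge_wedgelC x s b : x \in Lambda R 1 -> {subset s <= Lambda R 1} ->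
  x \w (wedgel s \w b) = (-1) ^+ size s *: (wedgel s \w (x \w b)).
Proof.
by move=> x1 /wedgel_Lambda s1; rewrite !wedgeA (wedgeC x1 s1) mul1n wedgeZl.
Qed.


(** Prepending an index below all others creates no inversion, so every sign is 1. This identifies
    the products of 1-forms in [dlist] with basis forms. *)
Lemma wedgel_sorted (s : seq 'I_6) : sorted (relpre val ltn) s ->
  wedgel [seq e j | j <- s] = ebase R [set j in s].
Proof.
elim: s => [_|i s IH] /=; first by congr ebase; apply/setP=> x; rewrite !inE.
rewrite (path_sortedE (relpre_trans (f := val) ltn_trans)) => /andP[/allP ltis /IH ->].
rewrite wedge_ebase /wedge_coef disjoints1 inE.
have -> : i \notin s by apply/negP => /ltis /=; rewrite ltnn.
rewrite wsignE big_set1 big1 => [|j]; last first.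
  by rewrite inE => /ltis /= lij; rewrite ltnNge ltnW.
by rewrite scale1r; congr ebase; apply/setP=> x; rewrite !inE.
Qed.

Lemma sorted_enum_set (I : {set 'I_6}) : sorted (relpre val ltn) (enum I).
Proof.
rewrite -sorted_map; apply: (subseq_sorted ltn_trans _ (iota_ltn_sorted 0 6)).
by rewrite -val_enum_ord enumT; apply: map_subseq; apply: filter_subseq.
Qed.

Lemma enum_sorted (s : seq 'I_6) :
  sorted (relpre val ltn) s -> enum [set j in s] = s.
Proof.
move=> ss; apply: (irr_sorted_eq (relpre_trans (f := val) ltn_trans)) => //.
- by move=> x /=; rewrite ltnn.
- exact: sorted_enum_set.
- by move=> x; rewrite mem_enum inE.
Qed.

(** * The Chevalley-Eilenberg differential on basis forms *)

Section Differential.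
Variable c : 'I_6 -> 'I_6 -> 'I_6 -> R.

Lemma dCE_is_linear : linear (dCE c).
Proof.
move=> k x y; rewrite /dCE scaler_sumr -big_split; apply: eq_bigr => I _ /=.
by rewrite !ffunE scalerDl scalerA.
Qed.
HB.instance Definition _ := GRing.isLinear.Build R (lform R) (lform R) _ (dCE c) dCE_is_linear.

Lemma dCE_ebase I : dCE c (ebase R I) = dlist c (enum I).
Proof.
rewrite /dCE (bigD1 I) //= big1 => [|J nJ]; rewrite ffunE.
  by rewrite eqxx scale1r addr0.
by rewrite (negPf nJ) scale0r.
Qed.

Lemma d1_Lambda i : d1 c i \in Lambda R 2.
Proof.
apply: memv_suml => j _; apply: memv_suml => k ltjk; apply: memvZ.
have := ebase_Lambda [set j; k].
by rewrite cards2 neq_ltn ltjk.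
Qed.

(** For [i] below all of [s] the enlarged set is enumerated as [i :: s], and the rule is one
    unfolding of [dlist]. *)
Lemma dCE_wedge_sorted (s : seq 'I_6) i : path (relpre val ltn) i s ->
  dCE c (e i \w ebase R [set j in s])
  = d1 c i \w ebase R [set j in s] - e i \w dCE c (ebase R [set j in s]).
Proof.
move=> si; have ss := path_sorted si.
have eis : e i \w ebase R [set j in s] = ebase R [set j in i :: s].
  by rewrite -wedgel_sorted // -(@wedgel_sorted (i :: s)).
by rewrite eis !dCE_ebase !enum_sorted //= wedgel_sorted.
Qed.

End Differential.
End Wedge.

(** * Leibniz rules for the differential *)

Section Leibniz.
Variable R : numFieldType.
Variable c : 'I_6 -> 'I_6 -> 'I_6 -> R.
Implicit Types (a b x y z : lform R) (I J K : {set 'I_6}).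

Local Notation "a \w b" := (wedge a b) (at level 40, left associativity).
Local Notation e i := (ebase R [set i]).

Lemma wedge1_id a : a \in Lambda R 1 -> a \w a = 0.
Proof.
move=> a1; apply/eqP; have /eqP := wedge1C a1 a1.
by rewrite -addr_eq0 -mulr2n -scaler_nat scaler_eq0 pnatr_eq0.
Qed.

(** Extends the defining recursion to an index in any position, by induction on the increasing index
    list of the other factor and comparison of [i] with its head. *)
Lemma dCE_wedge1 i b : dCE c (e i \w b) = d1 c i \w b - e i \w dCE c b.
Proof.
elim/form_ind: b => [|k u v Hu Hv|J].
- by rewrite wedge0r raddf0 !wedge0r subr0.
- rewrite wedge_linearr !dCE_is_linear !wedge_linearr Hu Hv.
  by rewrite scalerBr opprD addrACA.
have := sorted_enum_set J; have -> : J = [set j in enum J] by apply/setP => j; rewrite inE mem_enum.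
rewrite enum_sorted; last exact: sorted_enum_set.
elim: (enum J) i => {J} [|j t IH] i ss; first exact: dCE_wedge_sorted.
have st := path_sorted ss.
have ejt : ebase R [set k in j :: t] = e j \w ebase R [set k in t].
  by rewrite -wedgel_sorted // -(@wedgel_sorted _ t).
have e1 := @e_Lambda R; have d2 := @d1_Lambda R c.
case: (ltngtP i j) => [ltij|ltji|/val_inj ->].
- by apply: dCE_wedge_sorted; rewrite /= ltij.
- rewrite ejt wedge1CA // linearN /= dCE_wedge_sorted //.
  (* Wherever [i] falls relative to [t], the inner product is a multiple of a basis form whose
     indices all exceed [j], so the sorted case applies with [j] in front. *)
  have -> : dCE c (e j \w (e i \w ebase R [set k in t])) =
    d1 c j \w (e i \w ebase R [set k in t]) - e j \w dCE c (e i \w ebase R [set k in t]).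
    rewrite wedge_ebase !(linearZ, wedgeZr) /=.
    have -> : [set i] :|: [set k in t] = [set k in enum ([set i] :|: [set k in t])].
      by apply/setP => k; rewrite [in RHS]inE mem_enum.
    rewrite dCE_wedge_sorted; first by rewrite scalerDr.
    rewrite (path_sortedE (relpre_trans (f := val) ltn_trans)) sorted_enum_set andbT.
    apply/allP => k; rewrite mem_enum !inE => /predU1P[-> //|].
    by move: k; apply/allP; apply: order_path_min ss; apply: relpre_trans ltn_trans.
  rewrite IH // !wedgeDr !wedgeNr opprB [e i \w (e j \w _)]wedge1CA //.
  rewrite ![wedge (e _) (wedge (d1 _ _) _)]wedgeA -![e _ \w d1 c _]wedge2C // -!wedgeA.
  by rewrite opprK opprD addrAC addrA.
(* For [i = j] the left side is d 0, and the right side cancels because the 2-form [d1 c j] commutes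
   with [e j]. *)
rewrite ejt wedgeA wedge1_id // wedge0l linear0 dCE_wedge_sorted //.
rewrite wedgeDr wedgeNr !wedgeA wedge1_id // wedge0l subr0 [d1 c j \w e j]wedge2C //.
by rewrite subrr.
Qed.

Lemma dCE_wedge2 a b : a \in Lambda R 2 -> dCE c (a \w b) = dCE c a \w b + a \w dCE c b.
Proof.
elim/Lambda_ind => [|k u v Hu Hv|I /eqP/cards2P[i] [j] [nij ->]].
- by rewrite raddf0 !wedge0l raddf0 addr0.
- rewrite wedge_linearl !dCE_is_linear !wedge_linearl Hu Hv.
  by rewrite scalerDr addrACA.
have [s nz_s eij] : exists2 s, s != 0 & s *: ebase R [set i; j] = e i \w e j.
  exists (wedge_coef R [set i] [set j]); last by rewrite wedge_ebase.
  by rewrite /wedge_coef disjoints1 inE nij signr_eq0.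
apply: (scalerI nz_s); rewrite scalerDr -!wedgeZl -!linearZ /= -wedgeZl eij.
(* Writing [e j] as its product with the unit form lets the same rule compute its differential. *)
rewrite -wedgeA dCE_wedge1 dCE_wedge1 -[e j in RHS]wedge1r !dCE_wedge1.
rewrite dCE_ebase enum_set0 /= wedge0r subr0 wedge1r.
by rewrite !wedgeDl !wedgeDr !wedgeNl !wedgeNr !wedgeA !wedge1r opprB addrA addrAC.
Qed.

(** The two Leibniz terms coincide, a 2-form being central; this makes omega^2 closed. *)
Lemma dCE_sqr_eq0 a : a \in Lambda R 2 -> dCE c a \w a = 0 -> dCE c (a \w a) = 0.
Proof. by move=> a2 da; rewrite dCE_wedge2 // [a \w dCE c a]wedge2C // da addr0. Qed.

End Leibniz.

(** * The filtration of a coherent splitting *)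

Section Splitting.
Variable R : numFieldType.
Variable c : 'I_6 -> 'I_6 -> 'I_6 -> R.
Variables V1 V2 : {vspace lform R}.
Implicit Types (a b x y z : lform R) (s t : seq (lform R)).

Local Notation "a \w b" := (wedge a b) (at level 40, left associativity).
Local Notation e i := (ebase R [set i]).
Local Notation L p q := (Lpq V1 V2 p q).
Local Notation F k p := (Fkp V1 V2 k p).

(** [Lpq] indexes its generators by functions into a basis; lists of basis vectors are easier to
    extend by one factor. *)
Lemma map_tnth_vbasis (V : {vspace lform R}) s : {subset s <= vbasis V} ->
  exists f : {ffun 'I_(size s) -> 'I_(\dim V)},
    s = [seq tnth (vbasis V) (f i) | i <- enum 'I_(size s)].
Proof.
move=> sV.
have /fin_all_exists[f fE] (i : 'I_(size s)) : exists j, s`_i = tnth (vbasis V) j.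
  by apply/tnthP/sV/mem_nth.
exists (finfun f); apply: (@eq_from_nth _ 0) => [|i ltis]; first by rewrite size_map size_enum_ord.
rewrite (nth_map (Ordinal ltis)) ?size_enum_ord // ffunE -fE /=.
by rewrite nth_enum_ord.
Qed.

Lemma wedgel_Lpq s t : {subset s <= vbasis V1} -> {subset t <= vbasis V2} ->
  wedgel (s ++ t) \in L (size s) (size t).
Proof.
move=> /map_tnth_vbasis[f sE] /map_tnth_vbasis[g tE]; apply: memv_span.
by apply/allpairsP; exists (f, g); rewrite !mem_enum /= -sE -tE.
Qed.

Lemma Lpq_ind p q (P : lform R -> Prop) :
  P 0 -> (forall k u v, P u -> P v -> P (k *: u + v)) ->
  (forall s t, size s = p -> size t = q ->
     {subset s <= vbasis V1} -> {subset t <= vbasis V2} -> P (wedgel (s ++ t))) ->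
  forall x, x \in L p q -> P x.
Proof.
move=> P0 PD Pst; apply: span_ind => // x /allpairsP[[f g] [_ _ ->]].
by apply: Pst; rewrite ?size_map -?enumT ?size_enum_ord // => y /mapP[i _ ->]; apply: mem_tnth.
Qed.

Lemma Fkp_ind k p (P : lform R -> Prop) :
  P 0 -> (forall u v, P u -> P v -> P (u + v)) ->
  (forall p' q x, (p <= p')%N -> (p' + q)%N = k -> x \in L p' q -> P x) ->
  forall x, x \in F k p -> P x.
Proof.
move=> P0 PD PL x /memv_sumP[f fL ->]; elim/big_ind: _ => // i lepi.
(* Here [i <= k], so the truncated difference [k - i] in [Fkp] is exact. *)
by apply: PL (fL i lepi) => //; rewrite subnKC // -ltnS.
Qed.

Lemma Lpq_sub_Fkp p q k p0 : (p0 <= p)%N -> (p + q)%N = k -> (L p q <= F k p0)%VS.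
Proof.
move=> lep0 <-; have ltp : (p < (p + q).+1)%N by rewrite ltnS leq_addr.
by apply: (sumv_sup (Ordinal ltp)); rewrite //= addKn.
Qed.

Hypothesis V12 : (V1 + V2)%VS = Lambda R 1.

Lemma vbasis1_Lambda : {subset vbasis V1 <= Lambda R 1}.
Proof. by move=> x /vbasis_mem xV; rewrite -V12 (subvP (addvSl _ _)). Qed.

Lemma vbasis2_Lambda : {subset vbasis V2 <= Lambda R 1}.
Proof. by move=> x /vbasis_mem xV; rewrite -V12 (subvP (addvSr _ _)). Qed.

Lemma vbasis_ind (V : {vspace lform R}) (P : lform R -> Prop) :
  P 0 -> (forall k u v, P u -> P v -> P (k *: u + v)) ->
  (forall x, x \in vbasis V -> P x) -> forall v, v \in V -> P v.
Proof. by move=> P0 PD PX v; rewrite -(span_basis (vbasisP V)); apply: span_ind. Qed.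

(** Split [a] along V1 + V2. Its V1 part goes in front of the V1 factors; its V2 part moves past
    them, at the cost of a sign, and joins the V2 factors. *)
Lemma wedge1_Lpq p q a x :
  a \in Lambda R 1 -> x \in L p q -> a \w x \in (L p.+1 q + L p q.+1)%VS.
Proof.
rewrite -V12 => /memv_addP[a1 a1V [a2 a2V ->]] xL; rewrite wedgeDl memvD //.
  apply: (subvP (addvSl _ _)); elim/vbasis_ind: a1V => [|k u v Hu Hv|y yV].
  - by rewrite wedge0l mem0v.
  - by rewrite wedge_linearl memvD ?memvZ.
  elim/Lpq_ind: xL => [|k u v Hu Hv|s t <- <- sV tV].
  - by rewrite wedge0r mem0v.
  - by rewrite wedge_linearr memvD ?memvZ.
  by apply: (@wedgel_Lpq (y :: s)) => // z; rewrite inE => /predU1P[->|/sV].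
apply: (subvP (addvSr _ _)); elim/vbasis_ind: a2V => [|k u v Hu Hv|y yV].
- by rewrite wedge0l mem0v.
- by rewrite wedge_linearl memvD ?memvZ.
elim/Lpq_ind: xL => [|k u v Hu Hv|s t <- <- sV tV].
- by rewrite wedge0r mem0v.
- by rewrite wedge_linearr memvD ?memvZ.
rewrite wedgel_cat wedge_wedgelC ?vbasis2_Lambda // => [|z /sV/vbasis1_Lambda //].
apply: memvZ; rewrite -[y \w _]/(wedgel (y :: t)) -wedgel_cat.
by apply: wedgel_Lpq => // z; rewrite inE => /predU1P[->|/tV].
Qed.

Lemma wedgel_Fkp0 s : {subset s <= Lambda R 1} -> wedgel s \in F (size s) 0.
Proof.
elim: s => [_|a s IH sub].
  by apply: (subvP (@Lpq_sub_Fkp 0 0 0 0 _ _)) => //; apply: (@wedgel_Lpq [::] [::]).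
have a1 : a \in Lambda R 1 by apply: sub; rewrite inE eqxx.
have /IH {sub} /= : {subset s <= Lambda R 1} by move=> y ys; apply: sub; rewrite inE ys orbT.
elim/Fkp_ind => [|u v Hu Hv|p q x _ <- xL].
- by rewrite wedge0r mem0v.
- by rewrite wedgeDr memvD.
apply: subvP (wedge1_Lpq a1 xL); rewrite subv_add.
by rewrite !Lpq_sub_Fkp // addnS.
Qed.

(** Basis forms are products of 1-forms, and each 1-form factor decomposes along V1 + V2. *)
Lemma Lambda_sub_Fkp0 k : (Lambda R k <= F k 0)%VS.
Proof.
apply/subvP => x; elim/Lambda_ind => [|l u v Hu Hv|I <-]; first exact: mem0v.
  by rewrite memvD ?memvZ.
have -> : I = [set i in enum I] by apply/setP => i; rewrite inE mem_enum.
rewrite -wedgel_sorted ?sorted_enum_set // cardE enum_sorted ?sorted_enum_set //.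
rewrite -(size_map (fun i => e i) (enum I)); apply: wedgel_Fkp0.
by move=> y /mapP[i _ ->]; apply: e_Lambda.
Qed.

Hypothesis d_L0 : forall p a, a \in L p 0 -> dCE c a \in L p.+1 0.
Hypothesis d_LS : forall p q a, a \in L p q.+1 -> dCE c a \in (L p.+1 q.+1 + L p.+2 q)%VS.

(** Coherence makes every component of d raise p by 1 or 2, so d maps F^k_0, which contains all
    k-forms, into F^(k+1)_1. *)
Lemma Bk_sub_Fkp1 k : (Bk c k.+1 <= F k.+1 1)%VS.
Proof.
apply/subvP => _ /memv_imgP[x xk ->]; rewrite lfunE /=.
elim/Fkp_ind: (subvP (Lambda_sub_Fkp0 k) _ xk) => [|u v Hu Hv|p [|q] y _ <- yL].
- by rewrite raddf0 mem0v.
- by rewrite raddfD memvD.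
- by apply: subvP (d_L0 yL); rewrite Lpq_sub_Fkp.
apply: subvP (d_LS yL); rewrite subv_add.
by rewrite !Lpq_sub_Fkp // addnS.
Qed.

(** If h^{0,k+1} = 0, a dimension count makes Z /\ F_1 + B equal to Z /\ F_0 + B. The latter
    contains Z since F_0 contains all forms of this degree; the former lies in F_1 since B does. *)
Lemma Zk_sub_Fkp1 k : hpq c V1 V2 0 k.+1 = 0%N -> (Zk c k.+1 <= F k.+1 1)%VS.
Proof.
move=> /eqP; rewrite /hpq /dimHkp !add0n subn_eq0 leq_subLR.
(* B lies in the sum, so this truncated difference of dimensions is exact. *)
rewrite subnKC => [ledim|]; last exact/dimvS/addvSr.
have /eqP eqA : (Zk c k.+1 :&: F k.+1 1 + Bk c k.+1 == Zk c k.+1 :&: F k.+1 0 + Bk c k.+1)%VS.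
  rewrite eqEdim ledim andbT addvS // capvS //; apply/subvP => x.
  elim/Fkp_ind => [|u v|p q y _ <- yL]; [exact: mem0v|exact: memvD|].
  by apply: subvP yL; apply: Lpq_sub_Fkp.
have ZF0 : (Zk c k.+1 <= F k.+1 0)%VS by apply: subv_trans (Lambda_sub_Fkp0 _); apply: capvSr.
have: (Zk c k.+1 <= Zk c k.+1 :&: F k.+1 0 + Bk c k.+1)%VS.
  by apply: subv_trans (addvSl _ _); rewrite subv_cap subvv.
rewrite -eqA => /subv_trans; apply.
by rewrite subv_add Bk_sub_Fkp1 capvSr.
Qed.

(** Each generator of F_1 has a first factor in V1, a combination of [a] and [b], hence killed by
    [a \w b]. *)
Lemma Fkp1_wedge_eq0 k a b x : a \in Lambda R 1 -> b \in Lambda R 1 -> V1 = <<[:: a; b]>>%VS ->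
  x \in F k 1 -> x \w (a \w b) = 0.
Proof.
move=> a1 b1 V1E; have ab2 : a \w b \in Lambda R 2 by apply: (wedge_Lambda a1 b1).
elim/Fkp_ind => [|u v Hu Hv|[//|p] q y _ _]; first by rewrite wedge0l.
  by rewrite wedgeDl Hu Hv addr0.
elim/Lpq_ind => [|l u v Hu Hv|[//|v s] t _ _ sV _]; first by rewrite wedge0l.
  by rewrite wedge_linearl Hu Hv scaler0 addr0.
rewrite -wedge2C //= wedgeA.
suff -> : a \w b \w v = 0 by rewrite wedge0l.
have : v \in V1 by apply: vbasis_mem; apply: sV; rewrite inE eqxx.
rewrite V1E; elim/span_ind => [|l u w Hu Hw|z]; first by rewrite wedge0r.
  by rewrite wedge_linearr Hu Hw scaler0 addr0.
rewrite !inE => /orP[]/eqP->; last by rewrite -wedgeA wedge1_id // wedge0r.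
by rewrite wedge2C // wedgeA wedge1_id // wedge0l.
Qed.

End Splitting.

(** * Signs of index lists by insertion sort *)

(* [Some (b, v)]: the product of the factors listed in [s] is [(-1) ^+ b] times
   the product of the sorted list [v]; [None]: [s] has a repeated factor. *)
Fixpoint sinsert (n : nat) (s : seq nat) : option (bool * seq nat) :=
  if s is m :: s' then
    if (n < m)%N then Some (false, n :: s)
    else if (m < n)%N then
      if sinsert n s' is Some (b, v) then Some (~~ b, m :: v) else None
    else None
  else Some (false, [:: n]).

Fixpoint ssort (s : seq nat) : option (bool * seq nat) :=
  if s is n :: s' then
    if ssort s' is Some (b, v) then
      if sinsert n v is Some (b', v') then Some (b (+) b', v') else None
    else None
  else Some (false, [::]).

Lemma sinsert_sorted n s b v : sorted ltn s -> sinsert n s = Some (b, v) ->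
  sorted ltn v /\ perm_eq v (n :: s).
Proof.
elim: s b v => [|m s IH] b v; first by move=> _ [_ <-].
move=> ms /=; case: ltngtP => // [ltnm [_ <-]|ltmn]; first by rewrite /= ltnm.
case E: sinsert => [[b' v']|//] [_ <-].
have [sv' pv'] := IH _ _ (path_sorted ms) E; split; last first.
  rewrite -(perm_cons m) in pv'.
  by rewrite (perm_trans pv') // perm_sym (perm_catCA [:: n] [:: m] s).
rewrite /= (path_sortedE ltn_trans) sv' andbT (perm_all _ pv') /= ltmn /=.
exact: order_path_min ltn_trans ms.
Qed.

Lemma ssort_sorted s b v : ssort s = Some (b, v) -> sorted ltn v /\ perm_eq v s.
Proof.
elim: s b v => [|n s IH] b v /=; first by move=> [_ <-].
case E: ssort => [[b' v']|//]; have [sv' pv'] := IH _ _ E.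
case E': sinsert => [[b'' v'']|//] [_ <-].
have [sv'' pv''] := sinsert_sorted sv' E'; split=> //.
by rewrite (perm_trans pv'') // perm_cons.
Qed.

(** * The volume form of a coframe and coefficients in degree six *)

Section TopForm.
Variable R : numFieldType.
Implicit Types (x y z : lform R).
Local Notation "a \w b" := (wedge a b) (at level 40, left associativity).

Variable eta : nat -> lform R.
Hypothesis eta1 : forall n, eta n \in Lambda R 1.

(** Natural numbers as indices let signs and index lists be found by evaluation. *)
Definition mono (s : seq nat) : lform R := wedgel [seq eta n | n <- s].

Definition ssign (s : seq nat) : R :=
  if ssort s is Some (b, _) then (-1) ^+ b else 0.

Lemma mono_cat s t : mono (s ++ t) = mono s \w mono t.
Proof. by rewrite /mono map_cat wedgel_cat. Qed.

Lemma mono_cons n s : mono (n :: s) = eta n \w mono s.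
Proof. by []. Qed.

Lemma mono_sinsert n s :
  eta n \w mono s = if sinsert n s is Some (b, v) then (-1) ^+ b *: mono v else 0.
Proof.
elim: s => [|m s IH] /=; first by rewrite scale1r.
case: ltngtP => [_|_|->]; first by rewrite scale1r.
  rewrite mono_cons wedge1CA // IH.
  case: sinsert => [[b v]|]; last by rewrite wedge0r oppr0.
  by rewrite wedgeZr signrN scaleNr.
by rewrite mono_cons wedgeA wedge1_id // wedge0l.
Qed.

Lemma mono_ssort s :
  mono s = if ssort s is Some (b, v) then (-1) ^+ b *: mono v else 0.
Proof.
elim: s => [|n s IH] /=; first by rewrite scale1r.
rewrite mono_cons IH; case: ssort => [[b v]|]; last by rewrite wedge0r.
rewrite wedgeZr mono_sinsert; case: sinsert => [[b' v']|]; last by rewrite scaler0.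
by rewrite scalerA signr_addb.
Qed.

(** Six distinct indices below 6 sort to [iota 0 6]; a repeated index makes both sides 0. *)
Lemma mono_top s : size s = 6 -> all (fun n => n < 6)%N s ->
  mono s = ssign s *: mono (iota 0 6).
Proof.
move=> s6 /allP lts6; rewrite mono_ssort /ssign; case E: ssort => [[b v]|]; last by rewrite scale0r.
have [sv pv] := ssort_sorted E; congr (_ *: mono _).
apply: (irr_sorted_eq ltn_trans ltnn) => //.
have uv : uniq v by apply: (sorted_uniq ltn_trans ltnn).
have sub6 : {subset v <= iota 0 6} by move=> n; rewrite (perm_mem pv) mem_iota => /lts6.
by case: (uniq_min_size uv sub6) => //; rewrite size_iota (perm_size pv) s6.
Qed.

Hypothesis eta_span : (Lambda R 1 <= <<[seq eta n | n <- iota 0 6]>>)%VS.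

(** Multilinear expansion one factor at a time: [t] collects the factors already replaced by
    elements of [X], [s] those still to be expanded. *)
Lemma wedgel_span_eq0 (X : seq (lform R)) k :
  (forall s, {subset s <= X} -> size s = k -> wedgel s = 0) ->
  forall s t, {subset t <= X} -> {subset s <= <<X>>%VS} -> size (t ++ s) = k ->
  wedgel (t ++ s) = 0.
Proof.
move=> X0; elim=> [|x s IH] t tX sX st; first by apply: X0; rewrite ?cats0 // -[t]cats0.
have sX' : {subset s <= <<X>>%VS} by move=> y ys; apply: sX; rewrite inE ys orbT.
have {sX} : x \in <<X>>%VS by apply: sX; rewrite inE eqxx.
rewrite size_cat /= in st.
elim/span_ind => [|l u v Hu Hv|y yX].
- by rewrite wedgel_cat /= wedge0l wedge0r.
- rewrite !wedgel_cat /= in Hu Hv *.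
  by rewrite wedge_linearl wedge_linearr Hu Hv scaler0 addr0.
rewrite -cat_rcons; apply: IH => // [z|]; last by rewrite size_cat size_rcons addSnnS.
by rewrite mem_rcons inE => /predU1P[->|/tX].
Qed.

(** Were it zero, every product of six coframe elements would vanish, hence by multilinearity every
    product of six 1-forms, including the nonzero form built from the standard dual basis. *)
Lemma mono_top_neq0 : mono (iota 0 6) != 0.
Proof.
apply/negP => /eqP T0.
have : ebase R [set i in enum 'I_6] != 0.
  by apply/eqP => /ffunP/(_ [set i in enum 'I_6]); rewrite !ffunE eqxx; apply/eqP/oner_neq0.
have s6 : sorted (relpre val ltn) (enum 'I_6).
  by rewrite -sorted_map val_enum_ord iota_ltn_sorted.
rewrite -wedgel_sorted // => /eqP; apply.
apply: (@wedgel_span_eq0 [seq eta n | n <- iota 0 6] 6 _ _ [::]) => // [s sX s6'|x|].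
- have [t tE tall] : exists2 t, s = [seq eta n | n <- t] & all (fun n => n < 6)%N t.
    elim: s sX {s6'} => [|x s IH] sX; first by exists [::].
    have [|t -> allt] := IH; first by move=> y ys; apply: sX; rewrite inE ys orbT.
    have /mapP[n] : x \in [seq eta n | n <- iota 0 6] by apply: sX; rewrite inE eqxx.
    by rewrite mem_iota => ltn6 ->; exists (n :: t); rewrite //= allt andbT.
  have t6 : size t = 6 by move: s6'; rewrite tE size_map.
  by rewrite tE -/(mono t) mono_top // T0 scaler0.
- by case/mapP=> i _ ->; apply: (subvP eta_span); apply: e_Lambda.
by rewrite size_map size_enum_ord.
Qed.

Variables a b : nat -> R.
Let al := \sum_(n <- iota 0 6) a n *: eta n.
Let be := \sum_(n <- iota 0 6) b n *: eta n.

(** When [u] and [v] have four indices in total, this is the coefficient of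
    [mono u \w (al \w be) \w mono v] on the volume form. *)
Definition mono_coef (u v : seq nat) : R :=
  \sum_(m <- iota 0 6) \sum_(n <- iota 0 6) a m * b n * ssign (u ++ [:: m, n & v]).

(* The nonzero terms of [mono_coef], which can be listed by computation. *)
Definition mono_terms (u v : seq nat) : seq (bool * nat * nat) :=
  pmap (fun p => omap (fun bv => (bv.1, p.1, p.2)) (ssort (u ++ [:: p.1, p.2 & v])))
    (allpairs pair (iota 0 6) (iota 0 6)).

Lemma mono_coefE u v :
  mono_coef u v = \sum_(t <- mono_terms u v) (-1) ^+ t.1.1 * (a t.1.2 * b t.2).
Proof.
rewrite /mono_terms big_pmap big_allpairs_dep; apply: eq_bigr => m _; apply: eq_bigr => n _.
by rewrite /ssign /=; case: ssort => [[? ?]|] /=; rewrite ?mulr0 // mulrC.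
Qed.

Lemma mono_wedge2 u v : (size u + size v)%N = 4 -> all (fun n => n < 6)%N (u ++ v) ->
  mono u \w (al \w be) \w mono v = mono_coef u v *: mono (iota 0 6).
Proof.
rewrite all_cat => suv /andP[allu allv].
rewrite /mono_coef scaler_suml.
have [sl sr] := (@wedge_suml R _ (iota 0 6), @wedge_sumr R _ (iota 0 6)).
rewrite sl sr sl !big_seq; apply: eq_bigr => m; rewrite mem_iota => ltm6.
rewrite !sr sl scaler_suml !big_seq; apply: eq_bigr => n; rewrite mem_iota => ltn6.
rewrite -scalerA -mono_top; first last.
- by rewrite all_cat allu /= allv andbT; apply/andP.
- by rewrite size_cat /= !addnS suv.
rewrite mono_cat !mono_cons !(wedgeZl, wedgeZr) scalerA; congr (_ *: _).
by rewrite !wedgeA.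
Qed.

(** Multiplication by [mono v] brings the equation into top degree, where it becomes scalar because
    the volume form is nonzero. *)
Lemma mono_coef_sum_eq0 (l : seq (R * seq nat)) v :
  all (fun p => (size p.2 + size v == 4)%N && all (fun n => n < 6)%N (p.2 ++ v)) l ->
  (\sum_(p <- l) p.1 *: mono p.2) \w (al \w be) = 0 ->
  \sum_(p <- l) p.1 * mono_coef p.2 v = 0.
Proof.
move=> /allP lP /(congr1 (fun x => x \w mono v)).
rewrite wedge0l => l0; apply/eqP.
suff: (\sum_(p <- l) p.1 * mono_coef p.2 v) *: mono (iota 0 6) == 0.
  by rewrite scaler_eq0 (negPf mono_top_neq0) orbF.
apply/eqP; rewrite -[RHS]l0 scaler_suml !(wedge_suml l).
rewrite !big_seq; apply: eq_bigr => p /lP/andP[/eqP sz lt6].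
by rewrite !wedgeZl mono_wedge2 // scalerA.
Qed.

End TopForm.

(** [mono_terms] involves no scalars, so for concrete [u] and [v] it evaluates to an explicit list
    although the field is abstract. *)
Ltac compute_mono_terms := repeat match goal with
  | |- context [mono_terms ?u ?v] =>
    let l := eval vm_compute in (mono_terms u v) in
    have -> : mono_terms u v = l by vm_compute
  end.

(** * Decomposable 2-forms annihilating omega^2 and psi+ *)

Section HalfFlat.
Variable R : realFieldType.
Local Notation "a \w b" := (wedge a b) (at level 40, left associativity).

(* With z_j = a_(2j) + i a_(2j+1) and w_j = b_(2j) + i b_(2j+1), the first hypothesis is
   Im <z, w> = 0 and the others are the components of the cross product z x w = 0,
   so Lagrange's identity turns Cauchy-Schwarz into an equality. *)
Lemma complex_lagrange_eq (a b : nat -> R) :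
  a 0 * b 1 - a 1 * b 0 + (a 2 * b 3 - a 3 * b 2) + (a 4 * b 5 - a 5 * b 4) = 0 ->
  a 3 * b 4 - a 4 * b 3 + (a 2 * b 5 - a 5 * b 2) = 0 ->
  a 2 * b 4 - a 4 * b 2 - (a 3 * b 5 - a 5 * b 3) = 0 ->
  a 1 * b 4 - a 4 * b 1 + (a 0 * b 5 - a 5 * b 0) = 0 ->
  a 0 * b 4 - a 4 * b 0 - (a 1 * b 5 - a 5 * b 1) = 0 ->
  a 1 * b 2 - a 2 * b 1 + (a 0 * b 3 - a 3 * b 0) = 0 ->
  a 0 * b 2 - a 2 * b 0 - (a 1 * b 3 - a 3 * b 1) = 0 ->
  forall n, (n < 6)%N ->
  (\sum_(m <- iota 0 6) b m ^+ 2) * a n = (\sum_(m <- iota 0 6) a m * b m) * b n.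
Proof.
move=> h0 h1 h2 h3 h4 h5 h6.
set N := \sum_(m <- iota 0 6) b m ^+ 2; set r := \sum_(m <- iota 0 6) a m * b m.
pose A := \sum_(m <- iota 0 6) a m ^+ 2.
have NA : N * A - r ^+ 2 = 0.
  transitivity ((a 0 * b 1 - a 1 * b 0 + (a 2 * b 3 - a 3 * b 2) + (a 4 * b 5 - a 5 * b 4)) ^+ 2
    + (a 3 * b 4 - a 4 * b 3 + (a 2 * b 5 - a 5 * b 2)) ^+ 2
    + (a 2 * b 4 - a 4 * b 2 - (a 3 * b 5 - a 5 * b 3)) ^+ 2
    + (a 1 * b 4 - a 4 * b 1 + (a 0 * b 5 - a 5 * b 0)) ^+ 2
    + (a 0 * b 4 - a 4 * b 0 - (a 1 * b 5 - a 5 * b 1)) ^+ 2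
    + (a 1 * b 2 - a 2 * b 1 + (a 0 * b 3 - a 3 * b 0)) ^+ 2
    + (a 0 * b 2 - a 2 * b 0 - (a 1 * b 3 - a 3 * b 1)) ^+ 2).
    by rewrite /N /A /r /= !big_cons !big_nil; ring.
  by rewrite h0 h1 h2 h3 h4 h5 h6 expr0n /= !addr0.
(* Equality case of Cauchy-Schwarz in the form |N a - r b|^2 = N (N A - r^2), which avoids dividing
   by [N]. *)
have sq0 : \sum_(m <- iota 0 6) (N * a m - r * b m) ^+ 2 = 0.
  transitivity (N * (N * A - r ^+ 2)); last by rewrite NA mulr0.
  by rewrite /A /N /r /= !big_cons !big_nil; ring.
move=> n ltn6; apply/eqP; rewrite -subr_eq0 -sqrf_eq0; apply/eqP.
move: sq0 => /eqP; rewrite psumr_eq0 => [/allP/(_ n)|m _]; last exact: sqr_ge0.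
by rewrite mem_iota => /(_ ltn6)/eqP.
Qed.

Definition omega_index : seq (seq nat) := [:: [:: 0; 1]; [:: 2; 3]; [:: 4; 5]]%N.
(** Signed monomials of the real part of (eta0 + i eta1)(eta2 + i eta3)(eta4 + i eta5). *)
Definition psi_index : seq (R * seq nat) :=
  [:: (1, [:: 0; 2; 4]%N); (-1, [:: 0; 3; 5]%N); (-1, [:: 1; 2; 5]%N); (-1, [:: 1; 3; 4]%N)].

(** The bracket is Im <z, w>; the factor 2 arises because each monomial of omega^2 occurs twice. *)
Lemma omega_sqr_coef (a b : nat -> R) :
  \sum_(p <- [seq (1 : R, u ++ v) | u <- omega_index, v <- omega_index])
     p.1 * mono_coef a b p.2 [::] =
  2 * (a 0 * b 1 - a 1 * b 0 + (a 2 * b 3 - a 3 * b 2) + (a 4 * b 5 - a 5 * b 4)).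
Proof.
rewrite big_allpairs_dep /omega_index !big_cons !big_nil !mono_coefE.
by compute_mono_terms; rewrite !big_cons !big_nil /=; ring.
Qed.

(** The entries are in turn the imaginary and real parts of the three components of z x w; the minus
    signs belong to the middle one, z_2 w_0 - z_0 w_2. *)
Lemma psi_coef (a b : nat -> R) n : (n < 6)%N ->
  \sum_(p <- psi_index) p.1 * mono_coef a b p.2 [:: n] =
  [:: a 3 * b 4 - a 4 * b 3 + (a 2 * b 5 - a 5 * b 2);
      a 2 * b 4 - a 4 * b 2 - (a 3 * b 5 - a 5 * b 3);
      - (a 1 * b 4 - a 4 * b 1 + (a 0 * b 5 - a 5 * b 0));
      - (a 0 * b 4 - a 4 * b 0 - (a 1 * b 5 - a 5 * b 1));
      a 1 * b 2 - a 2 * b 1 + (a 0 * b 3 - a 3 * b 0);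
      a 0 * b 2 - a 2 * b 0 - (a 1 * b 3 - a 3 * b 1)]`_n.
Proof.
rewrite /psi_index !big_cons !big_nil !mono_coefE.
by case: n => [|[|[|[|[|[|//]]]]]] _; compute_mono_terms;
  rewrite !big_cons !big_nil /=; ring.
Qed.

Variable eta : nat -> lform R.
Hypothesis eta1 : forall n, eta n \in Lambda R 1.
Hypothesis eta_span : (Lambda R 1 <= <<[seq eta n | n <- iota 0 6]>>)%VS.

Let om := \sum_(u <- omega_index) mono eta u.
Let psi := \sum_(p <- psi_index) p.1 *: mono eta p.2.

Lemma mono_sum_sqr (l : seq (seq nat)) :
  (\sum_(u <- l) mono eta u) \w (\sum_(u <- l) mono eta u) =
  \sum_(p <- [seq (1 : R, u ++ v) | u <- l, v <- l]) p.1 *: mono eta p.2.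
Proof.
rewrite big_allpairs_dep (wedge_suml l); apply: eq_bigr => u _; rewrite (wedge_sumr l).
by apply: eq_bigr => v _; rewrite scale1r mono_cat.
Qed.

Lemma Lambda1_coord x : x \in Lambda R 1 ->
  exists a : nat -> R, x = \sum_(n <- iota 0 6) a n *: eta n.
Proof.
move/(subvP eta_span); elim/span_ind => [|k _ _ [a ->] [b ->]|y /mapP[n n6 ->]].
- by exists (fun=> 0); rewrite big1 // => n _; rewrite scale0r.
- exists (fun n => k * a n + b n); rewrite scaler_sumr -big_split; apply: eq_bigr => n _ /=.
  by rewrite scalerA scalerDl.
exists (fun m => (m == n)%:R); rewrite (bigD1_seq n) ?iota_uniq //= eqxx scale1r.
by rewrite big1 ?addr0 // => m /negPf ->; rewrite scale0r.
Qed.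

(** The coefficient equations yield N al = r be with N = |w|^2 and r = Re <z, w>, and N can be
    inverted because [be] is nonzero. *)
Lemma SU3_annihilator_dependent al be : al \in Lambda R 1 -> be \in Lambda R 1 ->
  om \w om \w (al \w be) = 0 -> psi \w (al \w be) = 0 -> be != 0 -> al \in <[be]>%VS.
Proof.
move=> /Lambda1_coord[a alE] /Lambda1_coord[b beE] om0 psi0 be0.
rewrite alE beE in om0 psi0.
rewrite mono_sum_sqr in om0.
(* This form already has degree six, so the test monomial is empty; the psi+ equation has degree
   five and is tested against each [eta n]. *)
have {om0}omC := mono_coef_sum_eq0 eta1 eta_span (v := [::]) _ om0.
have psiC n : (n < 6)%N -> \sum_(p <- psi_index) p.1 * mono_coef a b p.2 [:: n] = 0.
  by move=> ltn6; apply: (mono_coef_sum_eq0 eta1 eta_span _ psi0); rewrite /= ltn6.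
pose N := \sum_(m <- iota 0 6) b m ^+ 2; pose r := \sum_(m <- iota 0 6) a m * b m.
have Nr n : (n < 6)%N -> N * a n = r * b n.
  have psiE k (ltk6 : (k < 6)%N) := etrans (esym (psi_coef a b ltk6)) (psiC k ltk6).
  apply: complex_lagrange_eq.
  - by apply: (@mulfI _ 2); rewrite ?pnatr_eq0 // mulr0 -omega_sqr_coef omC.
  - exact: (psiE 0).
  - exact: (psiE 1).
  - by apply: oppr_inj; rewrite oppr0; apply: (psiE 2).
  - by apply: oppr_inj; rewrite oppr0; apply: (psiE 3).
  - exact: (psiE 4).
  - exact: (psiE 5).
have NalE : N *: al = r *: be.
  rewrite alE beE !scaler_sumr !big_seq; apply: eq_bigr => n; rewrite mem_iota => ltn6.
  by rewrite !scalerA Nr.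
(* In an ordered field a vanishing sum of squares would kill every coefficient of [be]. *)
have N0 : N != 0.
  apply: contraNneq be0 => /eqP; rewrite psumr_eq0 => [/allP b0|n _]; last exact: sqr_ge0.
  rewrite beE big_seq big1 // => n n6.
  by have := b0 n n6; rewrite /= sqrf_eq0 => /eqP ->; rewrite scale0r.
by apply/vlineP; exists (N^-1 * r); rewrite -scalerA -NalE scalerA mulVf // scale1r.
Qed.

End HalfFlat.

(** * Nonexistence of half-flat structures *)

Theorem theorem2 (R : realType) (c : 'I_6 -> 'I_6 -> 'I_6 -> R)
  (V1 V2 : {vspace lform R}) :
  is_lie c -> coherent_splitting c V1 V2 ->
  hpq c V1 V2 0 4 = 0%N -> hpq c V1 V2 0 3 = 0%N ->
  ~ (exists om psp : lform R, half_flat c om psp).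
Proof.
move=> _ [V12 _ dV1 d_L0 d_LS] h04 h03 [om [psp [[eta' [_ [eta_basis omE psE _]]] [dom dps]]]].
(* Beyond 5, [inord] returns a default index; this keeps every [eta n] a 1-form, and only indices
   below 6 enter the formulas. *)
pose eta n := eta' (inord n).
have etaE (i : 'I_6) n : val i = n -> eta' i = eta n by move=> <-; rewrite /eta inord_val.
have eta_span : <<[seq eta n | n <- iota 0 6]>>%VS = Lambda R 1.
  rewrite -(span_basis eta_basis); congr <<_>>%VS.
  rewrite -val_enum_ord -map_comp; apply: eq_map => i /=.
  by rewrite -(etaE i).
have eta1 n : eta n \in Lambda R 1.
  by rewrite -(span_basis eta_basis); apply: memv_span; apply: map_f; rewrite mem_enum.
have {}omE : om = \sum_(u <- omega_index) mono eta u.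
  rewrite omE /omega_index !big_cons big_nil /mono /= !wedge1r addr0 addrA.
  by rewrite /w2 !(etaE _ _ erefl).
have {}psE : psp = \sum_(p <- psi_index R) p.1 *: mono eta p.2.
  rewrite psE /psi_index !big_cons big_nil /mono /= !wedge1r addr0 !addrA.
  by rewrite /w3 !scaleN1r scale1r !(etaE _ _ erefl).
have mono_Lambda (s : seq nat) : mono eta s \in Lambda R (size s).
  by rewrite -(size_map eta); apply: wedgel_Lambda => x /mapP[n _ ->].
have om2 : om \in Lambda R 2.
  rewrite omE big_seq; apply: memv_suml => u.
  by rewrite !inE => /or3P[]/eqP->; apply: mono_Lambda.
have ps3 : psp \in Lambda R 3.
  rewrite psE big_seq; apply: memv_suml => p.
  by rewrite !inE => /or4P[]/eqP->; apply: memvZ; apply: mono_Lambda.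
have ZF k x : hpq c V1 V2 0 k.+1 = 0%N -> x \in Lambda R k.+1 -> dCE c x = 0 ->
    x \in Fkp V1 V2 k.+1 1.
  move=> hk xk dx; apply: (subvP (Zk_sub_Fkp1 V12 d_L0 d_LS hk)).
  by rewrite memv_cap xk memv_ker lfunE /= dx eqxx.
have omF : wedge om om \in Fkp V1 V2 4 1.
  by apply: ZF => //; [apply: (wedge_Lambda om2 om2)|apply: dCE_sqr_eq0].
have psF : psp \in Fkp V1 V2 3 1 by apply: ZF.
(* The type of [vbasis V1] depends on its dimension, so it is generalized before that dimension is
   rewritten to 2 and the tuple is taken apart. *)
have := vbasisP V1; move: (vbasis V1) (@vbasis1_Lambda _ _ _ V12); rewrite dV1.
case/tupleP => al t; case/tupleP: t => be t; rewrite (tuple0 t) => sub1 /= bV1.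
have al1 : al \in Lambda R 1 by apply: sub1; rewrite !inE eqxx.
have be1 : be \in Lambda R 1 by apply: sub1; rewrite !inE eqxx orbT.
have V1E := esym (span_basis bV1).
(* Freeness says that [be] is nonzero and [al] lies off its line, contrary to the dependence forced
   by the two annihilation equations. *)
have := basis_free bV1; rewrite free_cons seq1_free span_seq1 => /andP[/negP nal be0].
apply: nal; apply: (SU3_annihilator_dependent eta1 _ al1 be1) => //.
- by rewrite eta_span subvv.
- by rewrite -omE; apply: Fkp1_wedge_eq0 omF.
- by rewrite -psE; apply: Fkp1_wedge_eq0 psF.
Qed.
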